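(* Let $p>5$ be a prime and $r_1,r_2\in\mathbb Q\cap\mathbb Z_p^\times$, and assume that the multiset $\boldsymbol\alpha=\{r_1,1-r_1,r_2,1-r_2\}$ is closed under Dwork's dash operation. Then for every integer $s\ge1$, $$F_{s+1}(\boldsymbol\alpha)\equiv F_s(\boldsymbol\alpha)F_1(\boldsymbol\alpha)\pmod{p^3}.$$
   Context: For $x\in\mathbb Z_p$, $[x]_0\in\{0,\dots,p-1\}$ is its first $p$-adic digit ($x\equiv[x]_0\bmod p$). Dwork's dash operation sends $r\in\mathbb Q\cap\mathbb Z_p^\times$ to $r'=(r+[-r]_0)/p\in\mathbb Q\cap\mathbb Z_p^\times$; ''closed under the dash operation'' means the multiset $\{r'_1,\dots,r'_4\}$ of dashes of the four entries equals $\boldsymbol\alpha$ as a multiset. For $s\ge1$, $F_s(\boldsymbol\alpha)=\sum_{k=0}^{p^s-1}\frac{(r_1)_k(1-r_1)_k(r_2)_k(1-r_2)_k}{k!^4}$, with $(x)_k=x(x+1)\cdots(x+k-1)$. *)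

(* Defs.v *)
From mathcomp Require Import all_boot all_order all_algebra.

Set Implicit Arguments.
Unset Strict Implicit.
Unset Printing Implicit Defensive.

Import Order.TTheory GRing.Theory Num.Theory.
Local Open Scope ring_scope.

(* All p-adic numbers involved are rational, so Z_p only enters through
   Q \cap Z_p, the localization of Z at p, viewed inside rat. *)
Definition padic_int (p : nat) (x : rat) : bool := ~~ (p %| `|denq x|)%N.

(* x != 0 is needed because 0^-1 = 0 in MathComp. *)
Definition padic_unit (p : nat) (x : rat) : bool :=
  [&& x != 0, padic_int p x & padic_int p x^-1].

(* x = y mod p^n Z_p *)
Definition padic_eqmod (p n : nat) (x y : rat) : bool :=
  padic_int p ((x - y) / p%:R ^+ n).

(* The digit [x]_0. The entry at position d of iota 0 p is d, so the position
   returned by find is the digit itself; for x outside Z_p the (irrelevant)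
   value is p. *)
Definition digit0 (p : nat) (x : rat) : nat :=
  find (fun d : nat => padic_eqmod p 1 x d%:R) (iota 0 p).

Definition dash (p : nat) (r : rat) : rat := (r + (digit0 p (- r))%:R) / p%:R.

(* Multisets of rationals are sequences up to perm_eq. *)
Definition alpha (r1 r2 : rat) : seq rat := [:: r1; 1 - r1; r2; 1 - r2].

Definition dash_closed (p : nat) (a : seq rat) : bool :=
  perm_eq [seq dash p r | r <- a] a.

Definition poch (x : rat) (k : nat) : rat := \prod_(i < k) (x + i%:R).

Definition Ftrunc (p s : nat) (r1 r2 : rat) : rat :=
  \sum_(k < p ^ s)
    (poch r1 k * poch (1 - r1) k * poch r2 k * poch (1 - r2) k)
      / (k`!)%:R ^+ 4.

(* Main.v *)
(* Write r_i = e_i - d_i with 0 <= d_i < p and e_i = p r_i', so that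
   (1 - r_i)' = 1 - r_i', and let B(k) be the k-th summand of F.  Then
   B(bp + a) = B(bp) H_a(bp), where
     H_a(x) = prod_i (r_i + x)_a (1 - r_i + x)_a / (1 + x)_a^4.
   Put K(x) = kap d_1 e_1 x * kap d_2 e_2 x, a p-adic unit for x in p Z_p.
   Splitting the factors divisible by p off (r)_{bp}, and using closure under
   the dash to replace the r_i' by the r_i, gives
   B(bp) K(0) = B(b) K(bp) mod p^3 B(b), because
   (z + 1)...(z + p - 1) = (p - 1)! mod p^3 whenever p divides z.  It remains to
   see that K(x) sum_{a < p} H_a(x) takes the same value mod p^3 at x = 0 and at
   x = y = bp.  As K is a polynomial of degree 2p - 2, the residues of
   K(t) / prod_{j < p} (t - j)(t - y - j) add up to 0.  Its residues at a and at
   y + a are, up to a constant, -K(0) H_a(0) lam and K(y) H_a(y) lam' with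
   lam = lam' mod p^3 and lam = 1 mod p^2. *)
Require Import Defs.
From HB Require Import structures.
From mathcomp Require Import all_boot all_order all_algebra.
From mathcomp Require Import qpoly ring zify.

Set Implicit Arguments.
Unset Strict Implicit.
Unset Printing Implicit Defensive.

Import Order.TTheory GRing.Theory Num.Theory.
Local Open Scope ring_scope.

(* Membership form of [padic_int], which can carry a subring structure. *)
Definition zloc (p : nat) : {pred rat} := padic_int p.

(* (z + 1)...(z + k): a p-adic unit for z in p Z_p and k < p, unlike [poch z k]. *)
Definition shfact (z : rat) (k : nat) : rat := poch (1 + z) k.

(** * Rising factorials and their splittings *)

Lemma pochS x k : poch x k.+1 = poch x k * (x + k%:R).
Proof. by rewrite /poch big_ord_recr. Qed.

Lemma pochD x k l : poch x (k + l) = poch x k * poch (x + k%:R) l.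
Proof.
rewrite /poch big_split_ord; congr (_ * _).
by apply: eq_bigr => i _; rewrite /= natrD addrA.
Qed.

Lemma shfactS z k : shfact z k.+1 = shfact z k * (z + k.+1%:R).
Proof. by rewrite /shfact pochS -natr1; congr (_ * _); ring. Qed.

Lemma shfactD z k l : shfact z (k + l) = shfact z k * shfact (z + k%:R) l.
Proof. by rewrite /shfact pochD addrA. Qed.

Lemma shfact_fact k : shfact 0 k = k`!%:R.
Proof.
elim: k => [|k IH]; first by rewrite /shfact /poch big_ord0.
by rewrite shfactS IH add0r factS natrM mulrC.
Qed.

Lemma shfact_poch z k x l : x = z + k%:R + 1 -> shfact z (k + l) = shfact z k * poch x l.
Proof. by move=> ->; rewrite shfactD /shfact; congr (_ * poch _ _); ring. Qed.

(** * Vanishing of the sum of residues *)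

(** Compare coefficients of degree [n - 1] in Lagrange's interpolation formula: the one of [q]
    vanishes by the size bound, and each basis polynomial is a monic polynomial of degree [n - 1]
    divided by its value at the node. *)
Lemma sum_residues (K : fieldType) (n : nat) (x : nat -> K) (q : {poly K}) :
  injective x -> (size q < n)%N ->
  \sum_(i < n) q.[x i] / \prod_(j < n | j != i :> nat) (x i - x j) = 0.
Proof.
move=> xI qn; have n0 : (0 < n)%N by apply: leq_ltn_trans qn.
have /(congr1 (fun h : {poly K} => h`_n.-1)) := lagrange_gen n0 xI (ltnW qn).
rewrite [LHS]nth_default; last by rewrite -ltnS (ltn_predK n0).
rewrite coef_sum => h; rewrite [RHS]h; apply: eq_bigr => i _.
have := size_lagrange_ n0 xI i; rewrite lagrangeE //=.
set P := \prod_(j < n | _) _; have -> : \prod_(j < n | j != i :> nat) (x i - x j) = P.[x i].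
  by rewrite horner_prod; apply: eq_bigr => j _; rewrite hornerXsubC.
have Pi0 : P.[x i]^-1 != 0.
  rewrite invr_eq0 horner_prod; apply/prodf_neq0 => j ji.
  by rewrite hornerXsubC subr_eq0 (inj_eq xI) eq_sym.
rewrite size_Cmul // => sP; rewrite !coefCM -[in P`_ _]sP.
suff /monicP : P \is monic by rewrite lead_coefE => ->; rewrite mulr1.
by apply: monic_prod => j _; exact: monicXsubC.
Qed.

Section SuperCongruence.
Variable p : nat.
Hypothesis p_pr : prime p.

(** * The localization of the integers at p and its units *)

(** The reduced denominator divides any denominator: cross-multiply and cancel the coprime
    numerator. *)
Lemma zloc_frac (n d : int) : ~~ (p %| `|d|)%N -> n%:~R / d%:~R \in zloc p.
Proof.
move=> pd; have d0 : d != 0 by apply: contraNneq pd => ->; rewrite dvdn0.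
rewrite unfold_in /zloc /padic_int; apply: contra pd => /dvdn_trans; apply.
set x := _ / _; have : numq x * d = n * denq x.
  apply: (@intr_inj rat); rewrite !rmorphM /= numqE mulrAC /x divfK //.
  by rewrite intr_eq0.
move=> /(congr1 (fun z => `|z|%N)); rewrite !abszM => E.
have := coprime_num_den x; rewrite coprime_sym => /Gauss_dvdr <-.
by rewrite E dvdn_mull.
Qed.

Lemma zlocP (x : rat) :
  reflect (exists n d : int, ~~ (p %| `|d|)%N /\ x = n%:~R / d%:~R) (x \in zloc p).
Proof.
apply: (iffP idP) => [xp|[n [d [pd ->]]]]; last exact: zloc_frac.
by exists (numq x), (denq x); rewrite divq_num_den.
Qed.

Lemma zloc_subring : subring_closed (zloc p).
Proof.
split=> [|x y /zlocP[n [d [pd ->]]] /zlocP[m [e [pe ->]]]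
         |x y /zlocP[n [d [pd ->]]] /zlocP[m [e [pe ->]]]].
- by rewrite -[1](@divr1 rat); apply: (@zloc_frac 1 1); rewrite dvdn1; case: p p_pr => [|[]].
- have d0 : d%:~R != 0 :> rat by rewrite intr_eq0; apply: contraNneq pd => ->; rewrite dvdn0.
  have e0 : e%:~R != 0 :> rat by rewrite intr_eq0; apply: contraNneq pe => ->; rewrite dvdn0.
  have -> : n%:~R / d%:~R - m%:~R / e%:~R = (n * e - m * d)%:~R / (d * e)%:~R :> rat.
    by rewrite rmorphB !rmorphM /=; field; rewrite d0 e0.
  by apply: zloc_frac; rewrite abszM Euclid_dvdM // negb_or pd.
- rewrite mulf_div -!rmorphM /=.
  by apply: zloc_frac; rewrite abszM Euclid_dvdM // negb_or pd.
Qed.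

HB.instance Definition _ := GRing.isSubringClosed.Build rat (zloc p) zloc_subring.

Lemma p_neq0 : p%:R != 0 :> rat.
Proof. by rewrite pnatr_eq0 -lt0n prime_gt0. Qed.

Lemma zloc_unitE (x : rat) : padic_unit p x = [&& x != 0, x \in zloc p & x^-1 \in zloc p].
Proof. by []. Qed.

Lemma zunit_neq0 x : padic_unit p x -> x != 0.
Proof. by case/and3P. Qed.

Lemma zunit_zloc x : padic_unit p x -> x \in zloc p.
Proof. by case/and3P. Qed.

Lemma zunitM x y : padic_unit p x -> padic_unit p y -> padic_unit p (x * y).
Proof.
rewrite !zloc_unitE => /and3P[x0 xp xV] /and3P[y0 yp yV].
by rewrite mulf_neq0 // invfM !rpredM.
Qed.

Lemma zunitV x : padic_unit p x -> padic_unit p x^-1.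
Proof. by rewrite !zloc_unitE invr_eq0 invrK => /and3P[-> -> ->]. Qed.

Lemma zunit1 : padic_unit p 1.
Proof. by rewrite zloc_unitE invr1 rpred1 oner_eq0. Qed.

Lemma zunit_prod (I : Type) (s : seq I) (Q : pred I) (f : I -> rat) :
  (forall i, Q i -> padic_unit p (f i)) -> padic_unit p (\prod_(i <- s | Q i) f i).
Proof.
move=> h; apply: (big_ind (fun x => padic_unit p x)) => //.
- exact: zunit1.
- exact: zunitM.
Qed.

Lemma zunit_nat n : ~~ (p %| n)%N -> padic_unit p n%:R.
Proof.
move=> pn; rewrite zloc_unitE rpred_nat /= pnatr_eq0.
have /(_ pn) := @zloc_frac 1 n; rewrite div1r => ->; rewrite andbT.
by apply: contraNneq pn => ->; rewrite dvdn0.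
Qed.

(** * Congruences modulo powers of p *)

(* The ideal p^n Z_(p); congruences mod p^n are written [x - y \in pI n]. *)
Definition pI (n : nat) : {pred rat} := fun x => x / p%:R ^+ n \in zloc p.

Lemma pIE n x : (x \in pI n) = (x / p%:R ^+ n \in zloc p).
Proof. by []. Qed.

Lemma eqmodE n x y : padic_eqmod p n x y = (x - y \in pI n).
Proof. by []. Qed.

Lemma pI_zmod n : zmod_closed (pI n).
Proof.
split=> [|x y]; first by rewrite pIE mul0r rpred0.
by rewrite !pIE mulrBl; exact: rpredB.
Qed.

HB.instance Definition _ n := GRing.isZmodClosed.Build rat (pI n) (pI_zmod n).

Lemma pI0 x : (x \in pI 0) = (x \in zloc p).
Proof. by rewrite pIE expr0 divr1. Qed.

Lemma pI1 x : (x \in pI 1) = (x / p%:R \in zloc p).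
Proof. by []. Qed.

Lemma pIM m n x y : x \in pI m -> y \in pI n -> x * y \in pI (m + n).
Proof.
rewrite !pIE => xm yn; have := rpredM xm yn.
by rewrite mulrACA -invfM -exprD.
Qed.

Lemma pIMl n x y : x \in zloc p -> y \in pI n -> x * y \in pI n.
Proof. by rewrite -pI0; apply: pIM. Qed.

Lemma pIMr n x y : x \in pI n -> y \in zloc p -> x * y \in pI n.
Proof. by move=> xn yz; rewrite mulrC pIMl. Qed.

Lemma pIpX n : p%:R ^+ n \in pI n.
Proof. by rewrite pIE divff ?expf_neq0 ?p_neq0 ?rpred1. Qed.

Lemma pI_le m n x : (m <= n)%N -> x \in pI n -> x \in pI m.
Proof.
move=> mn; rewrite !pIE -(subnK mn); move: (n - m)%N => k xn.
have -> : x / p%:R ^+ m = x / p%:R ^+ (k + m) * p%:R ^+ k.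
  by rewrite exprD; field; rewrite !expf_neq0 ?p_neq0.
by rewrite rpredM // rpredX // rpred_nat.
Qed.

Lemma pI_zloc n x : x \in pI n -> x \in zloc p.
Proof. by rewrite -pI0; apply: pI_le. Qed.

(** Write [u + z = u * (1 + p w)] with [w = n / d]. Then [1 + p w = (d + p n) / d], and p does not
    divide [d + p n] since it does not divide [d]. *)
Lemma zunitDp u z : padic_unit p u -> z \in pI 1 -> padic_unit p (u + z).
Proof.
move=> uu; rewrite pI1 => zp; have u0 := zunit_neq0 uu.
have -> : u + z = u * (1 + p%:R * (z / p%:R / u)).
  by field; rewrite p_neq0 u0.
apply: zunitM => //.
have : z / p%:R / u \in zloc p by rewrite rpredM // zunit_zloc // zunitV.
move: (_ / u) => {uu zp u0} w /zlocP[n [d [pd ->]]].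
have d0 : d != 0 by apply: contraNneq pd => ->; rewrite dvdn0.
have pdn : ~~ (p %| `|(d + p%:Z * n)%R|)%N.
  have -> : (p %| `|(d + p%:Z * n)%R|)%N = (p%:Z %| d + p%:Z * n)%Z by [].
  by rewrite rpredDr // dvdz_mulr.
have dn0 : d + p%:Z * n != 0 by apply: contraNneq pdn => ->; rewrite dvdn0.
have -> : 1 + p%:R * (n%:~R / d%:~R) = (d + p%:Z * n)%:~R / d%:~R :> rat.
  by rewrite rmorphD rmorphM /=; field; rewrite intr_eq0.
rewrite zloc_unitE invf_div !zloc_frac // !andbT.
by rewrite mulf_neq0 ?invr_eq0 ?intr_eq0.
Qed.

Lemma eqmM n x x' y y' : x' \in zloc p -> y \in zloc p ->
  x - x' \in pI n -> y - y' \in pI n -> x * y - x' * y' \in pI n.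
Proof.
move=> xz yz hx hy; have -> : x * y - x' * y' = (x - x') * y + x' * (y - y') by ring.
by apply: rpredD; [apply: pIMr | apply: pIMl].
Qed.

Lemma eqm_zloc n x y : x - y \in pI n -> y \in zloc p -> x \in zloc p.
Proof. by move=> /pI_zloc h yz; rewrite -(subrK y x) rpredD. Qed.

Lemma eqm_prod n (I : Type) (s : seq I) (Q : pred I) (f g : I -> rat) :
  (forall i, Q i -> g i \in zloc p) -> (forall i, Q i -> f i - g i \in pI n) ->
  \prod_(i <- s | Q i) f i - \prod_(i <- s | Q i) g i \in pI n.
Proof.
move=> gz fg.
(* Integrality of the second product is carried along because [eqmM] needs it at each
   multiplication. *)
suff [] : \prod_(i <- s | Q i) g i \in zloc p /\
  \prod_(i <- s | Q i) f i - \prod_(i <- s | Q i) g i \in pI n by [].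
apply: (big_ind2 (fun x y => y \in zloc p /\ x - y \in pI n)).
- by rewrite subrr rpred1 rpred0.
- move=> x1 x2 y1 y2 [h1 h2] [h3 h4]; split; first exact: rpredM.
  by apply: eqmM => //; apply: eqm_zloc h4 h3.
- by move=> i Qi; split; [exact: gz | exact: fg].
Qed.

Lemma eqm_trans n y x z : x - y \in pI n -> y - z \in pI n -> x - z \in pI n.
Proof. by move=> h1 h2; have := rpredD h1 h2; rewrite addrA subrK. Qed.

Lemma eqmX n x y k : y \in zloc p -> x - y \in pI n -> x ^+ k - y ^+ k \in pI n.
Proof.
move=> yz xy; have xz := eqm_zloc xy yz.
elim: k => [|k IH]; first by rewrite subrr rpred0.
by rewrite !exprS; apply: eqmM; rewrite ?rpredX.
Qed.

Lemma eqmV n x y : padic_unit p x -> padic_unit p y -> x - y \in pI n ->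
  x^-1 - y^-1 \in pI n.
Proof.
move=> xu yu xy; have -> : x^-1 - y^-1 = - (x - y) * (x^-1 * y^-1).
  by field; rewrite !zunit_neq0.
by rewrite pIMr ?rpredN // rpredM // zunit_zloc // zunitV.
Qed.

Lemma eqm_div1 n x y : padic_unit p y -> x - y \in pI n -> x / y - 1 \in pI n.
Proof.
move=> yu h; rewrite -[X in _ - X](divff (zunit_neq0 yu)) -mulrBl.
by rewrite pIMr // zunit_zloc // zunitV.
Qed.

(** * Products of shifted factorials modulo p^3 *)

Hypothesis p_gt3 : (3 < p)%N.

Lemma zunit_nat_lt k : (0 < k < p)%N -> padic_unit p k%:R.
Proof. by move=> /andP[k0 kp]; apply: zunit_nat; rewrite gtnNdvd. Qed.

Lemma zunit_shfact z k : z \in pI 1 -> (k < p)%N -> padic_unit p (shfact z k).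
Proof.
move=> zp kp; apply: zunit_prod => i _; rewrite addrAC nat1r; apply: zunitDp => //.
by apply: zunit_nat_lt; rewrite /= (leq_ltn_trans _ kp).
Qed.

Lemma zloc_poch x k : x \in zloc p -> poch x k \in zloc p.
Proof. by move=> xz; apply: rpred_prod => i _; rewrite rpredD ?rpred_nat. Qed.

Lemma eqm_poch n x y k : y \in zloc p -> x - y \in pI n ->
  poch x k - poch y k \in pI n.
Proof.
move=> yz xy; apply: eqm_prod => i _; first by rewrite rpredD ?rpred_nat.
by rewrite /= (_ : _ - _ = x - y) //; ring.
Qed.

(** Elementary symmetric functions of degree at least 3 in the [c i] lie in p^3, and Newton's
    identity expresses the one of degree 2 through power sums. *)
Lemma trunc_prod (I : eqType) (s : seq I) (c : I -> rat) :
  {in s, forall i, c i \in pI 1} ->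
  \prod_(i <- s) (1 + c i) - (1 + \sum_(i <- s) c i +
     ((\sum_(i <- s) c i) ^+ 2 - \sum_(i <- s) c i ^+ 2) / 2%:R) \in pI 3.
Proof.
elim: s => [|i s IH] cp.
  by rewrite !big_nil (_ : _ - _ = 0) ?rpred0 //; field.
have ci : c i \in pI 1 by apply: cp; rewrite mem_head.
have {}cp : {in s, forall j, c j \in pI 1}.
  by move=> j js; apply: cp; rewrite inE js orbT.
move/(_ cp) in IH; rewrite !big_cons.
set P := \prod_(_ <- _) _ in IH *; set e := \sum_(_ <- _) _ in IH *.
set q := \sum_(_ <- _) _ in IH *.
have -> : (1 + c i) * P - (1 + (c i + e) + ((c i + e) ^+ 2 - (c i ^+ 2 + q)) / 2%:R)
  = (1 + c i) * (P - (1 + e + (e ^+ 2 - q) / 2%:R)) + c i * ((e ^+ 2 - q) / 2%:R).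
  by field.
apply: rpredD.
  by rewrite pIMl // rpredD ?rpred1 // (pI_zloc ci).
apply: (pIM (m := 1) (n := 2)) => //; apply: pIMr.
  have ep : e \in pI 1 by rewrite /e big_seq; apply: rpred_sum => j js; apply: cp.
  rewrite rpredB //; first exact: (pIM (m := 1) (n := 1)).
  by rewrite /q big_seq; apply: rpred_sum => j /cp cj; apply: (pIM (m := 1) (n := 1)).
apply/zunit_zloc/zunitV/zunit_nat_lt.
by rewrite /= ltnW.
Qed.

(** Exchange the products and pull out [j = i.+1]: by [trunc_prod], the product of the [1 + z / j]
    depends mod p^3 only on the sum of the z and the sum of their squares. Equal sizes match the
    powers of j, and equal sums leave an error proportional to the difference of the sums of
    squares. *)
Lemma eqm_prod_shfact n (zs ws : seq rat) a : (a < p)%N -> (n <= 3)%N ->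
  {in zs, forall z, z \in pI 1} -> {in ws, forall w, w \in pI 1} ->
  size zs = size ws -> \sum_(z <- zs) z = \sum_(w <- ws) w ->
  \sum_(z <- zs) z ^+ 2 - \sum_(w <- ws) w ^+ 2 \in pI n ->
  \prod_(z <- zs) shfact z a - \prod_(w <- ws) shfact w a \in pI n.
Proof.
move=> ap n3 zp wp szw s1 s2.
have E (s : seq rat) : \prod_(z <- s) shfact z a =
  \prod_(i < a) (i.+1%:R ^+ size s * \prod_(z <- s) (1 + z / i.+1%:R)).
  elim: s => [|z s IH]; first by rewrite big_nil big1 // => i _; rewrite big_nil mul1r.
  rewrite big_cons IH -big_split /=; apply: eq_bigr => i _.
  rewrite big_cons exprS -nat1r; field.
  by rewrite nat1r pnatr_eq0.
have F (s : seq rat) i : {in s, forall z, z \in pI 1} -> (i < p.-1)%N ->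
  \prod_(z <- s) (1 + z / i.+1%:R) - (1 + (\sum_(z <- s) z) / i.+1%:R +
     (((\sum_(z <- s) z) / i.+1%:R) ^+ 2 - (\sum_(z <- s) z ^+ 2) / i.+1%:R ^+ 2) / 2%:R) \in pI 3.
  move=> sp ip; have iu : i.+1%:R^-1 \in zloc p.
    by apply/zunit_zloc/zunitV/zunit_nat_lt; rewrite /= -(ltn_predK p_gt3) ltnS.
  have := @trunc_prod _ s (fun z => z / i.+1%:R).
  have -> : \sum_(z <- s) (z / i.+1%:R) ^+ 2 = (\sum_(z <- s) z ^+ 2) / i.+1%:R ^+ 2.
    by rewrite mulr_suml; apply: eq_bigr => z _; rewrite expr_div_n.
  rewrite -mulr_suml; apply => z /sp zI; exact: pIMr.
rewrite !E szw; apply: eqm_prod => i _.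
  rewrite rpredM ?rpredX ?rpred_nat // big_seq rpred_prod // => w /wp wI.
  rewrite rpredD ?rpred1 // rpredM ?(pI_zloc wI) //.
  apply/zunit_zloc/zunitV/zunit_nat_lt; rewrite /=.
  by rewrite (leq_ltn_trans (ltn_ord i)).
have ip : (i.+1 < p)%N by rewrite (leq_ltn_trans (ltn_ord i)).
have jV : i.+1%:R^-1 \in zloc p by apply/zunit_zloc/zunitV/zunit_nat_lt.
rewrite /= -mulrBr pIMl ?rpredX ?rpred_nat //.
have ip' : (i < p.-1)%N by rewrite -ltnS (ltn_predK p_gt3).
apply: eqm_trans (pI_le n3 (F zs i zp ip')) _.
rewrite -opprB rpredN; apply: eqm_trans (pI_le n3 (F ws i wp ip')) _.
rewrite s1; set u := \sum_(w <- ws) w; move: s2.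
set v := \sum_(z <- zs) _; set w := \sum_(w <- ws) _ => vw.
have -> : 1 + u / i.+1%:R + ((u / i.+1%:R) ^+ 2 - w / i.+1%:R ^+ 2) / 2%:R -
   (1 + u / i.+1%:R + ((u / i.+1%:R) ^+ 2 - v / i.+1%:R ^+ 2) / 2%:R)
   = (v - w) * ((i.+1%:R^-1) ^+ 2 * 2%:R^-1).
  by rewrite -nat1r; field; rewrite nat1r pnatr_eq0.
rewrite pIMr // rpredM // ?rpredX //.
by apply/zunit_zloc/zunitV/zunit_nat_lt; rewrite /= ltnW.
Qed.

Lemma ltn_ord_pred (i : 'I_p.-1) : (i.+1 < p)%N.
Proof. by have := ltn_ord i; move: (nat_of_ord i) => k; rewrite -ltnS (ltn_predK p_gt3). Qed.

(** Multiplication by 2 permutes the field, so the sum T satisfies [T = T / 4], hence [3 T = 0], and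
    3 is invertible. The term at 0 may be added freely because [0^-1 = 0]. *)
Lemma sum_invsq_Fp : \sum_(i < p.-1) (i.+1%:R ^+ 2)^-1 = 0 :> 'F_p.
Proof.
have pc : p \in [pchar 'F_p] by apply: pchar_Fp.
have n0 k : (0 < k < p)%N -> k%:R != 0 :> 'F_p.
  by move=> /andP[k0 kp]; rewrite -(dvdn_pcharf pc) gtnNdvd.
(* The bounds [p.-1.+1], [p] and the order of ['F_p] are equal but not convertible, and the index
   type depends on them. *)
have sumE n : n = p -> \sum_(i < n) (i%:R ^+ 2)^-1 = \sum_(i < p) (i%:R ^+ 2)^-1 :> 'F_p.
  by move=> ->.
have sumS n : \sum_(i < n) (i.+1%:R ^+ 2)^-1 = \sum_(i < n.+1) (i%:R ^+ 2)^-1 :> 'F_p.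
  by rewrite big_ord_recl expr0n invr0 add0r.
rewrite sumS (sumE _ (ltn_predK p_gt3)).
have -> : \sum_(i < p) (i%:R ^+ 2)^-1 = \sum_(x : 'F_p) (x ^+ 2)^-1 :> 'F_p.
  rewrite -(sumE _ (Fp_cast p_pr)); apply: eq_bigr => x _.
  by rewrite natr_Zp.
set T := \sum_(x : 'F_p) _.
have : T = (2%:R ^+ 2)^-1 * T.
  rewrite {1}/T (reindex_inj (h := fun x => 2%:R * x)) /=; last first.
    by apply: mulfI; apply: n0; rewrite /= ltnW.
  by rewrite mulr_sumr; apply: eq_bigr => x _; rewrite exprMn invfM.
have u4 : 2%:R != 0 :> 'F_p by apply: n0; rewrite /= ltnW.
move=> /(congr1 ( *%R (2%:R ^+ 2))); rewrite mulVKf ?expf_neq0 // => TE.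
have : 3%:R * T = 2%:R ^+ 2 * T - T by ring.
rewrite TE subrr.
by move/eqP; rewrite mulf_eq0 (negPf (n0 3 _)) // => /eqP.
Qed.

(** Clearing denominators with [(p - 1)!^2] gives an integer, whose divisibility by p can be read
    off in ['F_p]. *)
Lemma sum_invsq : \sum_(i < p.-1) (i.+1%:R ^+ 2)^-1 \in pI 1.
Proof.
set m := (p.-1)`!; have p0 := prime_gt0 p_pr.
have mu : padic_unit p m%:R.
  by rewrite -shfact_fact zunit_shfact ?rpred0 // ltn_predL.
have dm (i : 'I_p.-1) : (i.+1 %| m)%N by rewrite /m dvdn_fact //= ltn_ord.
pose N := (\sum_(i < p.-1) (m %/ i.+1) ^ 2)%N.
have pN : (p %| N)%N.
  rewrite (dvdn_pcharf (pchar_Fp p_pr)) /N natr_sum.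
  rewrite (eq_bigr (fun i : 'I_p.-1 => m%:R ^+ 2 * (i.+1%:R ^+ 2)^-1)).
    by rewrite -mulr_sumr sum_invsq_Fp mulr0.
  move=> i _; have i0 : i.+1%:R != 0 :> 'F_p.
    by rewrite -(dvdn_pcharf (pchar_Fp p_pr)) gtnNdvd // ltn_ord_pred.
  by rewrite natrX -{2}(divnK (dm i)) natrM exprMn mulfK ?expf_neq0.
have -> : \sum_(i < p.-1) (i.+1%:R ^+ 2)^-1 = N%:R * (m%:R ^+ 2)^-1 :> rat.
  rewrite /N natr_sum mulr_suml; apply: eq_bigr => i _.
  rewrite natrX -{2}(divnK (dm i)) natrM.
  have a0 : (m %/ i.+1)%N%:R != 0 :> rat.
    by rewrite pnatr_eq0 -lt0n divn_gt0 // dvdn_leq ?fact_gt0.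
  by rewrite -nat1r; field; rewrite nat1r pnatr_eq0 a0.
rewrite -exprVn pIMr ?rpredX ?zunit_zloc ?zunitV //.
by rewrite -(divnK pN) natrM pIMl ?rpred_nat // (pIpX 1).
Qed.

Lemma natr_pred_sub d : (d < p)%N -> (p.-1 - d)%:R = p%:R - 1 - d%:R :> rat.
Proof.
move=> dp; rewrite natrB; last by rewrite -ltnS (ltn_predK p_gt3).
by rewrite -{2}(ltn_predK p_gt3) -natr1 addrK.
Qed.

Lemma shfact_p z : shfact z p = shfact z p.-1 * (z + p%:R).
Proof. by case: p p_gt3 => // n _; rewrite shfactS. Qed.

Lemma shfact_rev z : shfact z p.-1 = \prod_(i < p.-1) (z + p%:R - i.+1%:R).
Proof.
rewrite /shfact /poch (reindex_inj rev_ord_inj); apply: eq_bigr => i _ /=.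
rewrite natrB //.
have -> : p%:R = p.-1%:R + 1 :> rat by rewrite natr1 (ltn_predK p_gt3).
by ring.
Qed.

(* Pairing j with p - j makes the square of the left-hand product a function of
   z(z + p), which lies in p^2 Z_(p), and the sum of the 1 / j^2 vanishes mod p. *)
Lemma shfact_pred z : z \in pI 1 -> shfact z p.-1 - (p.-1)`!%:R \in pI 3.
Proof.
move=> zp; rewrite -shfact_fact.
have ltp : (p.-1 < p)%N by rewrite ltn_predL prime_gt0.
have u0 := zunit_shfact (rpred0 _) ltp; have uz := zunit_shfact zp ltp.
have d1 : shfact z p.-1 - shfact 0 p.-1 \in pI 1.
  apply: eqm_poch; first by rewrite rpredD ?rpred1 ?rpred0.
  by rewrite (_ : _ - _ = z) //; ring.
(* This sum is twice a unit mod p, so the congruence between the squares descends to their roots. *)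
have ud : padic_unit p (shfact z p.-1 + shfact 0 p.-1).
  have -> : shfact z p.-1 + shfact 0 p.-1 =
    2%:R * shfact 0 p.-1 + (shfact z p.-1 - shfact 0 p.-1) by ring.
  by apply: zunitDp => //; apply: zunitM => //; apply: zunit_nat_lt; rewrite /= ltnW.
pose t := z * (z + p%:R).
have tp : t \in pI 2 by apply: (pIM (m := 1) (n := 1)) => //; rewrite rpredD // (pIpX 1).
pose v (i : 'I_p.-1) : rat := i.+1%:R * (p%:R - i.+1%:R).
have vu i : padic_unit p (v i).
  have ip := ltn_ord_pred i; rewrite /v -natrB ?(ltnW ip) //.
  by apply: zunitM; apply: zunit_nat_lt; lia.
have sqE y : shfact y p.-1 ^+ 2 = \prod_(i < p.-1) (v i + y * (y + p%:R)).
  rewrite expr2 {2}shfact_rev /shfact /poch -big_split; apply: eq_bigr => i _.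
  by rewrite /v /= -nat1r; ring.
have sq : shfact z p.-1 ^+ 2 - shfact 0 p.-1 ^+ 2 \in pI 3.
  have -> : shfact z p.-1 ^+ 2 = shfact 0 p.-1 ^+ 2 * \prod_(i < p.-1) (1 + t / v i).
    rewrite !sqE -big_split; apply: eq_bigr => i _ /=.
    by rewrite mul0r addr0 /t; move: (v i) (zunit_neq0 (vu i)) => w w0; field.
  rewrite -{2}[_ ^+ 2]mulr1 -mulrBr pIMl ?rpredX ?zunit_zloc //.
  have c2 i : t / v i \in pI 2 by rewrite pIMr // zunit_zloc // zunitV.
  have s3 : \sum_(i < p.-1) t / v i \in pI 3.
    rewrite -mulr_sumr; apply: (pIM (m := 2) (n := 1)) => //.
    (* With [j = i.+1], [1 / (j (p - j))] is [- 1 / j^2] mod p, which brings in [sum_invsq]. *)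
    rewrite -[X in X \in _](addrK (\sum_(i < p.-1) (i.+1%:R ^+ 2)^-1)) rpredB ?sum_invsq //.
    rewrite -big_split rpred_sum // => i _ /=.
    have vi := zunit_neq0 (vu i).
    have -> : (v i)^-1 + i.+1%:R ^- 2 = p%:R * ((v i)^-1 * i.+1%:R^-1).
      move: vi; rewrite /v; move: (i.+1%:R) (p%:R) => j q.
      by rewrite mulf_eq0 negb_or => /andP[h1 h2]; field; rewrite h1 h2.
    rewrite pIMr ?(pIpX 1) // rpredM //; first by rewrite zunit_zloc // zunitV.
    by rewrite zunit_zloc // zunitV // zunit_nat_lt ?ltn_ord_pred.
  apply: eqm_trans (trunc_prod _) _ => [i _|]; first exact: pI_le (c2 i).
  rewrite addrAC [1 + _]addrC addrK; apply: rpredD => //.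
  rewrite pIMr //; last by rewrite zunit_zloc // zunitV // zunit_nat_lt //= ltnW.
  apply: rpredB; first by apply: (pIM (m := 3) (n := 0)); rewrite // pI0 (pI_zloc s3).
  rewrite rpred_sum // => i _; apply: (pI_le (n := 4)) => //.
  exact: (pIM (m := 2) (n := 2)).
rewrite -[X in X \in _](mulfK (zunit_neq0 ud)) pIMr ?zunit_zloc ?zunitV //.
by rewrite -subr_sqr.
Qed.

(** * Digits and the dash operation *)

Lemma zloc_pV : (p%:R^-1 \in zloc p) = false.
Proof.
rewrite unfold_in /zloc /padic_int -[p%:R]/((p%:Z)%:~R) denqVz ?dvdnn //.
by rewrite -lt0n prime_gt0.
Qed.

Lemma pI1_unit u : padic_unit p u -> u \in pI 1 -> False.
Proof.
move=> uu; rewrite pI1 => up.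
have : u / p%:R * u^-1 \in zloc p by rewrite rpredM // zunit_zloc // zunitV.
by rewrite mulrAC divff ?zunit_neq0 // mul1r zloc_pV.
Qed.

Lemma digit_uniq x d e : (d < p)%N -> (e < p)%N ->
  x - d%:R \in pI 1 -> x - e%:R \in pI 1 -> d = e.
Proof.
wlog de : d e / (d <= e)%N => [hw dp ep hd he|dp ep hd he].
  by case/orP: (leq_total d e) => [/hw|/hw h]; [apply | apply/esym/h].
apply/eqP; rewrite eqn_leq de leqNgt; apply/negP => lt_de.
apply: (@pI1_unit (e - d)%:R); first by apply: zunit_nat_lt; lia.
by rewrite natrB //; have := rpredB hd he; rewrite (_ : _ - _ - _ = e%:R - d%:R) //; ring.
Qed.

(** For [x = n / m], Bezout's [v] inverts [m] mod p, and the digit is the remainder of [n * v]. *)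
Lemma digit_exists x : x \in zloc p -> exists2 d, (d < p)%N & x - d%:R \in pI 1.
Proof.
case/zlocP=> n [m [pm ->]]; have m0 : m != 0 by apply: contraNneq pm => ->; rewrite dvdn0.
have /coprimezP[[u v] /= uv] : coprimez p m by rewrite coprimezE prime_coprime.
have p0 : p%:Z != 0 by rewrite -lt0n prime_gt0.
have [d dE] : exists d : nat, ((n * v) %% p)%Z = d%:Z.
  by exists `|((n * v) %% p)%Z|%N; rewrite gez0_abs // modz_ge0.
exists d; first by rewrite -ltz_nat -dE ltz_pmod // ltz_nat prime_gt0.
have nE := divz_eq (n * v) p; rewrite dE in nE.
have -> : n%:~R / m%:~R - d%:R = p%:R * ((n * u + (n * v %/ p)%Z * m)%:~R / m%:~R) :> rat.
  have -> : d%:R = (n * v - (n * v %/ p)%Z * p)%:~R :> rat.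
    by rewrite {1}nE addrAC subrr add0r.
  rewrite -[p%:R]/((p%:Z)%:~R); have m0' : m%:~R != 0 :> rat by rewrite intr_eq0.
  apply: (mulIf m0'); rewrite mulrBl mulrA !divfK // -!rmorphM -rmorphB /=.
  by congr (_%:~R); rewrite -{1}(mulr1 n) -uv; ring.
by rewrite pIMr ?(pIpX 1) // zloc_frac.
Qed.

Lemma digit0P x : x \in zloc p -> (digit0 p x < p)%N /\ x - (digit0 p x)%:R \in pI 1.
Proof.
move=> /digit_exists[d dp xd]; rewrite /digit0; set a := fun _ : nat => _.
have ha : has a (iota 0 p) by apply/hasP; exists d; rewrite ?mem_iota.
have lt : (find a (iota 0 p) < p)%N by rewrite -{2}(size_iota 0 p) -has_find.
split=> //; have := nth_find 0%N ha; rewrite nth_iota //.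
Qed.

(** The first digits of [- r] and [- (1 - r)] add up to [p - 1], which makes the dash commute with
    [r -> 1 - r]. *)
Lemma dashE r : r \in zloc p -> exists d,
  [/\ (d < p)%N, dash p r \in zloc p, r = p%:R * dash p r - d%:R
    & dash p (1 - r) = 1 - dash p r].
Proof.
move=> rz; have nrz : - r \in zloc p by rewrite rpredN.
have [dp hd] := digit0P nrz; exists (digit0 p (- r)).
have hrd : r + (digit0 p (- r))%:R \in pI 1 by rewrite -rpredN opprD.
split=> //; first by rewrite /dash [p%:R * _]mulrC divfK ?p_neq0 // addrK.
have n1z : - (1 - r) \in zloc p by rewrite rpredN rpredB ?rpred1.
have [ep he] := digit0P n1z.
rewrite {1}/dash (@digit_uniq (- (1 - r)) _ (p.-1 - digit0 p (- r)) ep _ he).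
- by rewrite natr_pred_sub // /dash; field; rewrite p_neq0.
- by rewrite (leq_ltn_trans (leq_subr _ _)) // ltn_predL prime_gt0.
- rewrite natr_pred_sub // (_ : _ - _ = r + (digit0 p (- r))%:R - p%:R); last by ring.
  by rewrite rpredB // (pIpX 1).
Qed.

(** * Extracting the factors divisible by p *)

(* Chosen so that, for r = e - d, [kap d e (x + a)] and (r + x)_a (1 - r + x)_a agree
   up to factors [shfact z a] with z in p Z_(p): see [kap_shift]. *)
Definition kap (d : nat) (e x : rat) : rat :=
  shfact (x - e) d * shfact (x + e - p%:R) (p.-1 - d).

(** The share of the pair [r, 1 - r] in the k-th summand of F. *)
Definition wpair (r : rat) (k : nat) : rat := poch r k * poch (1 - r) k / k`!%:R ^+ 2.

Lemma zunit_kap d e x : (d < p)%N -> e \in pI 1 -> x \in pI 1 -> padic_unit p (kap d e x).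
Proof.
move=> dp ep xp; apply: zunitM; apply: zunit_shfact => //.
- exact: rpredB.
- by rewrite rpredB ?(pIpX 1) // rpredD.
- by rewrite (leq_ltn_trans (leq_subr _ _)) // ltn_predL prime_gt0.
Qed.

Lemma eqm_kap d e x y : (d < p)%N -> e \in pI 1 -> x \in pI 1 -> y \in pI 1 ->
  kap d e x - kap d e y \in pI 1.
Proof.
move=> dp ep xp yp.
have pp : (p%:R : rat) \in pI 1 := pIpX 1.
have sz z k : z \in pI 1 -> shfact z k \in zloc p.
  by move=> zI; apply: zloc_poch; rewrite rpredD ?rpred1 // (pI_zloc zI).
apply: eqmM.
- by apply: sz; rewrite rpredB.
- by apply: sz; rewrite rpredB // rpredD.
- apply: eqm_poch; first by rewrite rpredD ?rpred1 // rpredB ?(pI_zloc yp) ?(pI_zloc ep).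
  by rewrite (_ : _ - _ = x - y) ?rpredB //; ring.
- apply: eqm_poch.
    by rewrite rpredD ?rpred1 // rpredB ?rpredD ?(pI_zloc yp) ?(pI_zloc ep) ?(pI_zloc pp).
  by rewrite (_ : _ - _ = x - y) ?rpredB //; ring.
Qed.

(** Each Pochhammer symbol continues a factor of [kap d e x] to a longer run of consecutive factors;
    splitting that run at [a] instead gives the left-hand side. *)
Lemma kap_shift d e x a : (d < p)%N ->
  kap d e (x + a%:R) * (shfact (x + e - p%:R) a * shfact (x - e) a) =
  kap d e x * (poch (e - d%:R + x) a * poch (1 - (e - d%:R) + x) a).
Proof.
move=> dp; rewrite /kap.
have h1 : shfact (x - e) a * shfact (x - e + a%:R) d =
          shfact (x - e) d * poch (1 - (e - d%:R) + x) a.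
  by rewrite -shfactD addnC; apply: shfact_poch; ring.
have h2 : shfact (x + e - p%:R) a * shfact (x + e - p%:R + a%:R) (p.-1 - d) =
          shfact (x + e - p%:R) (p.-1 - d) * poch (e - d%:R + x) a.
  by rewrite -shfactD addnC; apply: shfact_poch; rewrite natr_pred_sub //; ring.
rewrite (_ : x + a%:R - e = x - e + a%:R); last by ring.
rewrite (_ : x + a%:R + e - p%:R = x + e - p%:R + a%:R); last by ring.
by apply: etrans (etrans (congr2 *%R h1 h2) _); ring.
Qed.

(** Induction on b. In the next p factors of each symbol, exactly one is divisible by p:
    [p (r' + b)], [p (1 - r' + b)] and, in the factorial, [p (b + 1)]; these yield the next step of
    [wpair r']. With the help of [kap], the others regroup into full runs [u1], [u2], [u3] of
    [p - 1] factors, all congruent to [(p - 1)!] mod p^3, and [v] collects their ratios. *)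
Lemma wpair_block d r' b : (d < p)%N -> r' \in zloc p -> let e := p%:R * r' in
  exists v, [/\ padic_unit p v, v - 1 \in pI 3 &
  wpair (e - d%:R) (b * p) * kap d e 0 = wpair r' b * v * kap d e (b * p)%:R].
Proof.
move=> dp rz e.
have p0 := p_neq0; have pp : (p%:R : rat) \in pI 1 := pIpX 1.
have ep : e \in pI 1 by rewrite /e pIMr.
elim: b => [|b [v [vu v1 IH]]].
  exists 1; split; rewrite ?zunit1 ?subrr ?rpred0 //.
  by rewrite mul0n /wpair /poch !big_ord0 fact0 !(mulr1, mul1r).
have ltp : (p.-1 < p)%N by rewrite ltn_predL prime_gt0.
set y : rat := (b * p)%:R; have yE : y = b%:R * p%:R by rewrite /y natrM.
have yp : y \in pI 1 by rewrite yE pIMl // rpred_nat.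
have yeI : y - e \in pI 1 by rewrite rpredB.
have yepI : y + e - p%:R \in pI 1 by rewrite rpredB // rpredD.
pose u1 := shfact (y + e - p%:R) p.-1; pose u2 := shfact (y - e) p.-1.
pose u3 := shfact y p.-1.
have u1u : padic_unit p u1 by apply: zunit_shfact.
have u2u : padic_unit p u2 by apply: zunit_shfact.
have u3u : padic_unit p u3 by apply: zunit_shfact.
exists (v * (u1 / u3 * (u2 / u3))); split.
- by rewrite !zunitM // zunitV.
- have q1 w : padic_unit p w -> w - p.-1`!%:R \in pI 3 -> w / u3 - 1 \in pI 3.
    move=> wu w1; apply: eqm_div1 => //; apply: eqm_trans w1 _.
    by rewrite -opprB rpredN shfact_pred.
  have z3 : padic_unit p u3^-1 by rewrite zunitV.
  rewrite -[X in _ - X](mulr1 1); apply: eqmM; rewrite ?rpred1 //.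
    by rewrite !rpredM ?zunit_zloc.
  rewrite -[X in _ - X](mulr1 1); apply: eqmM; rewrite ?rpred1 //.
  + by rewrite rpredM ?zunit_zloc.
  + by apply: q1 => //; apply: shfact_pred.
  + by apply: q1 => //; apply: shfact_pred.
have e1 : shfact (y + e - p%:R) (p.-1 - d) * poch (e - d%:R + y) p =
  u1 * (y + e) * shfact (y + e) (p.-1 - d).
  rewrite -(@shfact_poch (y + e - p%:R)); last by rewrite natr_pred_sub //; ring.
  rewrite addnC shfactD subrK; congr (_ * _).
  by rewrite shfact_p /u1; congr (_ * _); ring.
have e2 : shfact (y - e) d * poch (1 - (e - d%:R) + y) p =
  u2 * (y - e + p%:R) * shfact (y - e + p%:R) d.
  rewrite -(@shfact_poch (y - e)); last by ring.
  by rewrite addnC shfactD shfact_p.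
have e3 : (b.+1 * p)`!%:R = (b * p)`!%:R * (u3 * (y + p%:R)) :> rat.
  by rewrite mulSn addnC -!shfact_fact shfactD add0r shfact_p.
have k1 := zunit_neq0 (zunit_kap dp ep yp).
have u30 := zunit_neq0 u3u.
have f0 : (b * p)`!%:R != 0 :> rat by rewrite pnatr_eq0 -lt0n fact_gt0.
have f1 : b`!%:R != 0 :> rat by rewrite pnatr_eq0 -lt0n fact_gt0.
have b1 : b%:R + 1 != 0 :> rat by rewrite natr1 pnatr_eq0.
have w1 : wpair (e - d%:R) (b.+1 * p) = wpair (e - d%:R) (b * p) *
  (poch (e - d%:R + y) p * poch (1 - (e - d%:R) + y) p / (u3 * (y + p%:R)) ^+ 2).
  rewrite /wpair e3 mulSn addnC !pochD -/y yE; field.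
  rewrite u30 f0 /= (_ : b%:R * p%:R + p%:R = (b%:R + 1) * p%:R) ?mulf_neq0 //; ring.
have w2 : wpair r' b.+1 = wpair r' b * ((r' + b%:R) * (1 - r' + b%:R) / (b%:R + 1) ^+ 2).
  by rewrite /wpair !pochS factS natrM -natr1; field; rewrite f1 b1.
have kS : kap d e (b.+1 * p)%:R = shfact (y - e + p%:R) d * shfact (y + e) (p.-1 - d).
  by rewrite /kap mulSn natrD -/y; congr (shfact _ _ * shfact _ _); ring.
apply: (mulIf k1); rewrite w1 w2 kS.
have kE : kap d e y = shfact (y - e) d * shfact (y + e - p%:R) (p.-1 - d) by [].
rewrite {1}kE.
transitivity ((wpair (e - d%:R) (b * p) * kap d e 0) *
  ((shfact (y + e - p%:R) (p.-1 - d) * poch (e - d%:R + y) p) *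
   (shfact (y - e) d * poch (1 - (e - d%:R) + y) p)) / (u3 * (y + p%:R)) ^+ 2).
  by ring.
rewrite IH e1 e2 -/y yE /e; field.
rewrite u30 b1 /= (_ : b%:R * p%:R + p%:R = (b%:R + 1) * p%:R) ?mulf_neq0 //; ring.
Qed.

(** * The residue identity on two blocks of p nodes *)

Lemma shfactE z k : shfact z k = \prod_(1 <= i < k.+1) (z + i%:R).
Proof. by rewrite big_add1 big_mkord; apply: eq_bigr => i _; rewrite -nat1r; ring. Qed.

Definition wprod (a : nat) (z : rat) : rat := \prod_(j < p | j != a :> nat) (z + a%:R - j%:R).

(** The factors with [j < a] make up [shfact z a]; those with [j > a] are the last [p - 1 - a]
    factors of [shfact (z - p%:R) p.-1]. *)
Lemma wprodE a z : (a < p)%N ->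
  wprod a z * shfact (z - p%:R) a = shfact z a * shfact (z - p%:R) p.-1.
Proof.
move=> ap; rewrite /wprod -(big_mkord (fun j => j != a) (fun j => z + a%:R - j%:R)).
rewrite (big_cat_nat (n := a)) ?(ltnW ap) //= [X in _ * X * _]big_ltn_cond // eqxx /=.
have drop_cond m n : (a < m)%N || (n <= a)%N ->
    \prod_(m <= j < n | j != a) (z + a%:R - j%:R) = \prod_(m <= j < n) (z + a%:R - j%:R).
  move=> mn; rewrite big_nat_cond [RHS]big_nat_cond; apply: eq_bigl => j /=.
  by apply: andb_id2l => ?; rewrite /=; lia.
rewrite !drop_cond ?leqnn ?orbT // !shfactE (ltn_predK p_gt3).
rewrite [X in _ = _ * X](big_cat_nat (n := a.+1)) //= mulrA [RHS]mulrAC; congr (_ * _ * _).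
- rewrite big_nat_rev big_add1 /= !big_nat; apply: eq_bigr => j ja.
  by rewrite add0n natrB //; ring.
- rewrite big_nat_rev !big_nat; apply: eq_bigr => j /andP[aj jp] /=.
  by rewrite natrB ?natrD -?natr1; first ring; lia.
Qed.

(* The vanishing of the sum of residues at the nodes 0, ..., p - 1 and
   bp, ..., bp + p - 1. *)
Lemma lagrange_two_blocks (q : {poly rat}) b : (0 < b)%N -> (size q < p + p)%N ->
  \sum_(a < p) q.[(b * p)%:R + a%:R] / (wprod a (b * p)%:R * wprod a 0) =
  \sum_(a < p) q.[a%:R] / (wprod a (- (b * p)%:R) * wprod a 0).
Proof.
move=> b0 sq; set y : rat := (b * p)%:R.
have y0 : y != 0 by rewrite pnatr_eq0 -lt0n muln_gt0 b0 prime_gt0.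
(* [sum_residues] asks for injectivity on all of [nat], so the second block runs on without end;
   [0 < b] keeps it off the first. *)
pose x (i : nat) : rat := (if (i < p)%N then i else i - p + b * p)%N%:R.
have xI : injective x.
  move=> i j /eqP; rewrite eqr_nat => /eqP.
  have : (p <= b * p)%N by rewrite leq_pmull.
  by case: (ltnP i p) => ip; case: (ltnP j p) => jp; move: (b * p)%N => w; lia.
have xl (j : 'I_p) : x (lshift p j) = j%:R by rewrite /x /= ltn_ord.
have xr (j : 'I_p) : x (rshift p j) = y + j%:R.
  by rewrite /x /= ltnNge leq_addr /= addKn natrD addrC.
have := sum_residues xI sq; rewrite big_split_ord /=.
under eq_bigr => a _.
  rewrite big_split_ord /= xl.
  rewrite (eq_bigr (fun j : 'I_p => 0 + a%:R - j%:R)); last first.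
    by move=> j _; rewrite xl add0r.
  rewrite -/(wprod a 0) (eq_bigl predT); last first.
    by move=> j /=; rewrite gtn_eqF // ltn_addr.
  rewrite (bigD1 a) //= xr (eq_bigr (fun j : 'I_p => - y + a%:R - j%:R)); last first.
    by move=> j _; rewrite xr; ring.
  rewrite (eq_bigl (fun j : 'I_p => j != a :> nat)) // -/(wprod a (- y)).
  over.
under [X in _ + X]eq_bigr => a _.
  rewrite big_split_ord /= xr.
  rewrite (eq_bigl predT); last by move=> j /=; rewrite ltn_eqF // ltn_addr.
  rewrite (bigD1 a) //= xl (eq_bigr (fun j : 'I_p => y + a%:R - j%:R)); last first.
    by move=> j _; rewrite xl.
  rewrite (eq_bigl (fun j : 'I_p => j != a :> nat)) // -/(wprod a y).
  rewrite (eq_bigr (fun j : 'I_p => 0 + a%:R - j%:R)); last first.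
    by move=> j _; rewrite xr; ring.
  rewrite (eq_bigl (fun j : 'I_p => j != a :> nat)); last by move=> j /=; rewrite eqn_add2l.
  rewrite -/(wprod a 0).
  over.
move=> /= h; apply/eqP; rewrite -subr_eq0; apply/eqP.
(* Nodes with the same index in the two blocks differ by [y] up to sign, a factor that [wprod]
   leaves out. *)
apply: (mulfI (x := y^-1)); first by rewrite invr_eq0.
rewrite mulr0 -[RHS]h mulrBr addrC -mulrN -sumrN !mulr_sumr; congr (_ + _); apply: eq_bigr => a _.
  by rewrite (_ : y + a%:R - a%:R = y) ?invfM; ring.
by rewrite (_ : a%:R - (y + a%:R) = - y) ?invfM ?invrN; ring.
Qed.

Definition poly_poch (c : rat) (k : nat) : {poly rat} := \prod_(i < k) ('X - (- (c + i%:R))%:P).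

Lemma horner_poly_poch c k x : (poly_poch c k).[x] = poch (c + x) k.
Proof. by rewrite horner_prod; apply: eq_bigr => i _; rewrite hornerXsubC; ring. Qed.

Lemma size_poly_poch c k : size (poly_poch c k) = k.+1.
Proof. by rewrite size_prod_XsubC /index_enum -enumT size_enum_ord. Qed.

Definition kap_poly (d : nat) (e : rat) : {poly rat} :=
  poly_poch (1 - e) d * poly_poch (1 + e - p%:R) (p.-1 - d).

Lemma horner_kap_poly d e x : (kap_poly d e).[x] = kap d e x.
Proof.
rewrite hornerM !horner_poly_poch /kap /shfact.
by congr (poch _ _ * poch _ _); ring.
Qed.

Lemma size_kap_poly d e : (d < p)%N -> (size (kap_poly d e) <= p)%N.
Proof.
move=> dp; apply: leq_trans (size_polyMleq _ _) _.
by rewrite !size_poly_poch; lia.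
Qed.

(** * The sum over one block, modulo p^3 *)

(** The function H_a: at [x = n] it carries the n-th summand to the one of index [n + a], see
    [coeff_add]. *)
Definition hterm (r1 r2 : rat) (a : nat) (x : rat) : rat :=
  poch (r1 + x) a * poch (1 - r1 + x) a * (poch (r2 + x) a * poch (1 - r2 + x) a)
  / shfact x a ^+ 4.

Lemma zloc_hterm r1 r2 a x : r1 \in zloc p -> r2 \in zloc p -> x \in pI 1 -> (a < p)%N ->
  hterm r1 r2 a x \in zloc p.
Proof.
move=> r1z r2z xp ap; have xz := pI_zloc xp.
have ux : padic_unit p (shfact x a) by apply: zunit_shfact.
rewrite /hterm -exprVn rpredM ?rpredX ?(zunit_zloc (zunitV ux)) //.
by rewrite !rpredM ?zloc_poch ?rpredD ?rpredN ?rpred1.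
Qed.

Lemma eqm_hterm r1 r2 a x y : r1 \in zloc p -> r2 \in zloc p -> x \in pI 1 -> y \in pI 1 ->
  (a < p)%N -> hterm r1 r2 a x - hterm r1 r2 a y \in pI 1.
Proof.
move=> r1z r2z xp yp ap; have xz := pI_zloc xp; have yz := pI_zloc yp.
have ux : padic_unit p (shfact x a) by apply: zunit_shfact.
have uy : padic_unit p (shfact y a) by apply: zunit_shfact.
have pe r : r \in zloc p -> poch (r + x) a - poch (r + y) a \in pI 1.
  move=> rz; apply: eqm_poch; first exact: rpredD.
  by rewrite (_ : _ - _ = x - y) ?rpredB //; ring.
have zx r : r \in zloc p -> poch (r + x) a \in zloc p by move=> rz; rewrite zloc_poch // rpredD.
have zy r : r \in zloc p -> poch (r + y) a \in zloc p by move=> rz; rewrite zloc_poch // rpredD.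
have n1 r : r \in zloc p -> 1 - r \in zloc p by move=> rz; rewrite rpredB ?rpred1.
rewrite /hterm -!exprVn; apply: eqmM.
- by rewrite !rpredM ?zy ?n1.
- by rewrite rpredX // zunit_zloc ?zunitV.
- by do 2![apply: eqmM; rewrite ?rpredM ?zx ?zy ?pe ?n1 //].
apply: eqmX; rewrite ?zunit_zloc ?zunitV //; apply: eqmV => //.
apply: eqm_poch; first by rewrite rpredD ?rpred1.
by rewrite (_ : _ - _ = x - y) ?rpredB //; ring.
Qed.

Lemma kap_hterm_sum d1 d2 e1 e2 b : (d1 < p)%N -> (d2 < p)%N ->
  e1 \in pI 1 -> e2 \in pI 1 ->
  kap d1 e1 (b * p)%:R * kap d2 e2 (b * p)%:R *
    \sum_(a < p) hterm (e1 - d1%:R) (e2 - d2%:R) a (b * p)%:R -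
  kap d1 e1 0 * kap d2 e2 0 * \sum_(a < p) hterm (e1 - d1%:R) (e2 - d2%:R) a 0 \in pI 3.
Proof.
move=> d1p d2p e1p e2p.
pose K x := kap d1 e1 x * kap d2 e2 x.
rewrite -/(K (b * p)%:R) -/(K 0).
set r1 := e1 - d1%:R; set r2 := e2 - d2%:R.
have [b0|b0] := posnP b; first by rewrite b0 mul0n subrr rpred0.
set y : rat := (b * p)%:R.
have pp : (p%:R : rat) \in pI 1 := pIpX 1.
have yp : y \in pI 1 by rewrite /y natrM pIMl ?rpred_nat.
have r1z : r1 \in zloc p by rewrite rpredB ?rpred_nat ?(pI_zloc e1p).
have r2z : r2 \in zloc p by rewrite rpredB ?rpred_nat ?(pI_zloc e2p).
(* [lam a y y] and [lam a 0 (- y)] are the factors lam' and lam of the header. They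
   are congruent mod p^3 because the shifts in [zs y y ++ ws 0 (- y)] and in
   [zs 0 (- y) ++ ws y y] have the same sums and the same sums of squares. *)
pose zs (x z : rat) := [:: x; x; x; x; z - p%:R; - p%:R].
pose ws x z := [:: z; 0; x + e1 - p%:R; x - e1; x + e2 - p%:R; x - e2].
pose S a (s : seq rat) := \prod_(z <- s) shfact z a.
pose lam a x z := S a (zs x z) / S a (ws x z).
have zsI x z : x \in pI 1 -> z \in pI 1 -> {in zs x z, forall t, t \in pI 1}.
  by move=> xI zI t; rewrite !inE => /or4P[|||/or3P[]] /eqP ->; rewrite ?rpredB ?rpredN.
have wsI x z : x \in pI 1 -> z \in pI 1 -> {in ws x z, forall t, t \in pI 1}.
  move=> xI zI t; rewrite !inE => /or4P[|||/or3P[]] /eqP ->;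
  by rewrite ?rpred0 ?(rpredB, rpredD).
have Su a s : (a < p)%N -> {in s, forall t, t \in pI 1} -> padic_unit p (S a s).
  move=> ap sI; rewrite /S big_seq; apply: zunit_prod => t /sI tI.
  exact: zunit_shfact.
have Scat a s t : S a (s ++ t) = S a s * S a t by rewrite /S big_cat.
have sqI x : x \in pI 1 -> x ^+ 2 \in pI 2 by move=> xI; apply: (pIM (m := 1) (n := 1)).
(* Both lists have sum [4 x + z - 2 p], and all squares lie in p^2. *)
have lam1 a x z : (a < p)%N -> x \in pI 1 -> z \in pI 1 -> lam a x z - 1 \in pI 2.
  move=> ap xI zI; apply: eqm_div1; first by apply: Su => //; apply: wsI.
  apply: eqm_prod_shfact => //; [exact: zsI|exact: wsI| |].
    by rewrite !big_cons !big_nil; ring.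
  by rewrite !big_cons !big_nil; rewrite !(rpredB, rpredD, sqI, rpredN, rpred0).
have lam12 a : (a < p)%N -> lam a y y - lam a 0 (- y) \in pI 3.
  move=> ap; have nyp : - y \in pI 1 by rewrite rpredN.
  have i0 : 0 \in pI 1 by rewrite rpred0.
  have u1 := Su a _ ap (wsI y y yp yp); have u2 := Su a _ ap (wsI 0 (- y) i0 nyp).
  have -> : lam a y y - lam a 0 (- y) = (S a (zs y y ++ ws 0 (- y)) - S a (zs 0 (- y) ++ ws y y))
     * ((S a (ws y y))^-1 * (S a (ws 0 (- y)))^-1).
    by rewrite !Scat /lam; field; rewrite !zunit_neq0.
  rewrite pIMr //; last by rewrite rpredM // zunit_zloc // zunitV.
  apply: eqm_prod_shfact => //.
  - by move=> t; rewrite mem_cat => /orP[/zsI|/wsI]; apply.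
  - by move=> t; rewrite mem_cat => /orP[/zsI|/wsI]; apply.
  - by rewrite !big_cons !big_nil; ring.
  by rewrite !big_cons !big_nil (_ : _ - _ = 0) ?rpred0 //; ring.
pose c z := shfact (z - p%:R) p.-1.
have cu z : z \in pI 1 -> padic_unit p (c z).
  by move=> zI; rewrite zunit_shfact ?rpredB // ltn_predL prime_gt0.
(* [x = z = y] gives the residue at the node [y + a], and [x = 0], [z = - y] the one at [a]. Here
   [lam] gathers the [shfact] factors left over from [kap_shift], [wprodE] and the denominator of
   [hterm]. *)
have termE a x z : (a < p)%N -> x \in pI 1 -> z \in pI 1 ->
  (kap_poly d1 e1 * kap_poly d2 e2).[x + a%:R] / (wprod a z * wprod a 0)
  = K x * hterm r1 r2 a x * lam a x z / (c z * c 0).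
  move=> ap xI zI; rewrite hornerM !horner_kap_poly.
  have i0 : 0 \in pI 1 by rewrite rpred0.
  have Su1 t : t \in pI 1 -> shfact t a != 0 by move=> tI; apply/zunit_neq0/zunit_shfact.
  have k1 := kap_shift e1 x a d1p; have k2 := kap_shift e2 x a d2p.
  have wz := wprodE z ap; have w0 := wprodE 0 ap.
  have [cz c0] := (zunit_neq0 (cu z zI), zunit_neq0 (cu 0 i0)).
  have [A1 A2] : shfact (x + e1 - p%:R) a != 0 /\ shfact (x - e1) a != 0.
    by split; apply: Su1; rewrite ?(rpredB, rpredD).
  have [B1 B2] : shfact (x + e2 - p%:R) a != 0 /\ shfact (x - e2) a != 0.
    by split; apply: Su1; rewrite ?(rpredB, rpredD).
  have [C1 C2] : shfact (z - p%:R) a != 0 /\ shfact (- p%:R) a != 0.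
    by split; apply: Su1; rewrite ?rpredB ?rpredN.
  have [D1 D2 D3] : [/\ shfact x a != 0, shfact z a != 0 & shfact 0 a != 0].
    by split; apply: Su1.
  rewrite sub0r in w0.
  have {}k1 : kap d1 e1 (x + a%:R) = kap d1 e1 x *
      (poch (e1 - d1%:R + x) a * poch (1 - (e1 - d1%:R) + x) a) /
      (shfact (x + e1 - p%:R) a * shfact (x - e1) a).
    by rewrite -k1 mulfK // mulf_neq0.
  have {}k2 : kap d2 e2 (x + a%:R) = kap d2 e2 x *
      (poch (e2 - d2%:R + x) a * poch (1 - (e2 - d2%:R) + x) a) /
      (shfact (x + e2 - p%:R) a * shfact (x - e2) a).
    by rewrite -k2 mulfK // mulf_neq0.
  have {}wz : wprod a z = shfact z a * c z / shfact (z - p%:R) a.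
    by rewrite -wz mulfK.
  have {}w0 : wprod a 0 = shfact 0 a * c 0 / shfact (- p%:R) a.
    by rewrite /c sub0r -w0 mulfK.
  rewrite k1 k2 wz w0 /lam /S !big_cons !big_nil /hterm /K -/r1 -/r2; field.
  by rewrite A1 A2 B1 B2 C1 C2 D1 D2 D3 cz c0.
have nyp : - y \in pI 1 by rewrite rpredN.
have i0 : 0 \in pI 1 by rewrite rpred0.
have sq : (size (kap_poly d1 e1 * kap_poly d2 e2)%R < p + p)%N.
  apply: leq_ltn_trans (size_polyMleq _ _) _.
  have := leq_add (size_kap_poly e1 d1p) (size_kap_poly e2 d2p); lia.
have := lagrange_two_blocks b0 sq; rewrite -/y.
rewrite (eq_bigr (fun a : 'I_p => (K y * hterm r1 r2 a y * lam a y y) * (c y * c 0)^-1)); last first.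
  by move=> a _; rewrite termE.
rewrite [RHS](eq_bigr (fun a : 'I_p => (K 0 * hterm r1 r2 a 0 * lam a 0 (- y)) * (c (- y) * c 0)^-1)); last first.
  by move=> a _; rewrite -termE // add0r.
rewrite -!mulr_suml.
set T1 := \sum_(a < p) _; set T2 := \sum_(a < p) _ => TE.
have Kz x : x \in pI 1 -> K x \in zloc p.
  by move=> xI; rewrite /K rpredM // zunit_zloc // zunit_kap.
have lamz a x z : (a < p)%N -> x \in pI 1 -> z \in pI 1 -> lam a x z \in zloc p.
  by move=> ap xI zI; apply: eqm_zloc (lam1 a x z ap xI zI) (rpred1 _).
have T12 : T1 - T2 \in pI 3.
  (* [c y] and [c (- y)] are both [(p - 1)!] mod p^3, so the constants of the two residue sums are
     interchangeable. *)
  have -> : T1 - T2 = T2 * (c y / c (- y) - 1).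
    have [u1 u2 u3] := And3 (zunit_neq0 (cu y yp)) (zunit_neq0 (cu _ nyp)) (zunit_neq0 (cu 0 i0)).
    have -> : T1 = T1 / (c y * c 0) * (c y * c 0) by field; rewrite u1 u3.
    by rewrite TE; field; rewrite u2 u3.
  apply: pIMl.
    by apply: rpred_sum => a _; apply: rpredM; [apply: rpredM; [exact: Kz | exact: zloc_hterm] | exact: lamz].
  apply: eqm_div1; first exact: cu.
  apply: (eqm_trans (y := p.-1`!%:R)); first by rewrite shfact_pred // rpredB.
  by rewrite -opprB rpredN shfact_pred // rpredB.
rewrite -[X in X \in _](subrK (T1 - T2)) rpredD // !mulr_sumr /T1 /T2 -!sumrB.
apply: rpred_sum => a _.
(* The values of [K * hterm] at [y] and at 0 are compared only mod p, but their difference is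
   multiplied by [lam a y y - 1], which lies in p^2. *)
have -> : K y * hterm r1 r2 a y - K 0 * hterm r1 r2 a 0 -
    (K y * hterm r1 r2 a y * lam a y y - K 0 * hterm r1 r2 a 0 * lam a 0 (- y)) =
  (K 0 * hterm r1 r2 a 0 - K y * hterm r1 r2 a y) * (lam a y y - 1) -
  K 0 * hterm r1 r2 a 0 * (lam a y y - lam a 0 (- y)) by ring.
apply: rpredB; last by apply: pIMl; [apply: rpredM; [exact: Kz | exact: zloc_hterm] | exact: lam12].
apply: (pIM (m := 1) (n := 2)); last exact: lam1.
apply: eqmM; rewrite ?Kz ?zloc_hterm //; last exact: eqm_hterm.
by apply: eqmM; rewrite ?eqm_kap // zunit_zloc // zunit_kap.
Qed.

(** * Parameters closed under the dash, and the congruence for F *)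

Section DashClosed.
Variables r1 r2 : rat.
Hypotheses (r1z : r1 \in zloc p) (r2z : r2 \in zloc p).
Hypothesis closed : dash_closed p (alpha r1 r2).

Definition coeff (k : nat) : rat := wpair r1 k * wpair r2 k.

Lemma coeff_pochE k : coeff k =
  (poch r1 k * poch (1 - r1) k * poch r2 k * poch (1 - r2) k) / (k`!)%:R ^+ 4.
Proof.
have f0 : k`!%:R != 0 :> rat by rewrite pnatr_eq0 -lt0n fact_gt0.
by rewrite /coeff /wpair; field.
Qed.

Lemma coeff_add n a : coeff (n + a) = coeff n * hterm r1 r2 a n%:R.
Proof.
have f0 k : k`!%:R != 0 :> rat by rewrite pnatr_eq0 -lt0n fact_gt0.
have := f0 (n + a)%N; rewrite !coeff_pochE /hterm -!shfact_fact shfactD add0r !pochD.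
rewrite mulf_eq0 negb_or => /andP[h1 h2]; field.
by rewrite h1 h2.
Qed.

(** The numerator is a product over the multiset [alpha r1 r2], which the dash only permutes. *)
Lemma coeff_dash k : wpair (dash p r1) k * wpair (dash p r2) k = coeff k.
Proof.
have [_ [_ _ _ d1]] := dashE r1z; have [_ [_ _ _ d2]] := dashE r2z.
have : \prod_(r <- map (dash p) (alpha r1 r2)) poch r k = \prod_(r <- alpha r1 r2) poch r k.
  exact: perm_big.
rewrite /alpha /= !big_cons !big_nil d1 d2 coeff_pochE /wpair !mulr1 => E.
have f0 : k`!%:R != 0 :> rat by rewrite pnatr_eq0 -lt0n fact_gt0.
rewrite (_ : _ * poch (1 - r2) k = poch r1 k * (poch (1 - r1) k * (poch r2 k * poch (1 - r2) k))).
  by rewrite -E; field.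
by ring.
Qed.

(** The witness is [v1 * v2] times K(bp) / K(0). An exact factorization with integral [v] keeps the
    factor [coeff b] outside the congruence and also serves for [zloc_coeff]. *)
Lemma coeff_block b : exists v, [/\ v \in zloc p, coeff (b * p) = coeff b * v &
  v * \sum_(a < p) hterm r1 r2 a (b * p)%:R - \sum_(a < p) hterm r1 r2 a 0 \in pI 3].
Proof.
have [d1 [d1p s1z r1E _]] := dashE r1z; have [d2 [d2p s2z r2E _]] := dashE r2z.
have [v1 [v1u v11 E1]] := wpair_block b d1p s1z.
have [v2 [v2u v21 E2]] := wpair_block b d2p s2z.
have pp : (p%:R : rat) \in pI 1 := pIpX 1.
have e1p : p%:R * dash p r1 \in pI 1 by rewrite pIMr.
have e2p : p%:R * dash p r2 \in pI 1 by rewrite pIMr.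
have yp : (b * p)%:R \in pI 1 by rewrite natrM pIMl ?rpred_nat.
have := kap_hterm_sum b d1p d2p e1p e2p.
rewrite -r1E -r2E in E1 E2 *.
have i0 : 0 \in pI 1 by rewrite rpred0.
have := zunit_kap d1p e1p i0; have := zunit_kap d2p e2p i0.
have := zunit_kap d1p e1p yp; have := zunit_kap d2p e2p yp.
have hz : \sum_(a < p) hterm r1 r2 a (b * p)%:R \in zloc p.
  by apply: rpred_sum => a _; apply: zloc_hterm.
move: E1 E2 hz.
set k1 := kap d1 _ _; set k2 := kap d2 _ _; set l1 := kap d1 _ _; set l2 := kap d2 _ _.
set T := \sum_(a < p) _; set T0 := \sum_(a < p) _ => E1 E2 Tz l2u l1u k2u k1u TT0.
have [k10 k20] := (zunit_neq0 k1u, zunit_neq0 k2u).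
have qz : k1^-1 * k2^-1 \in zloc p by rewrite rpredM // zunit_zloc // zunitV.
have lz : l1 * l2 \in zloc p by rewrite rpredM // zunit_zloc.
have [v1z v2z] := (zunit_zloc v1u, zunit_zloc v2u).
exists (v1 * v2 * (l1 * l2 * (k1^-1 * k2^-1))); split.
- by apply: rpredM; apply: rpredM.
- apply: (mulIf k10); apply: (mulIf k20).
  rewrite -[coeff b]coeff_dash [LHS](_ : _ = (wpair r1 (b * p) * k1) * (wpair r2 (b * p) * k2)).
    by rewrite E1 E2; field; rewrite k10 k20.
  by rewrite /coeff; ring.
have -> : v1 * v2 * (l1 * l2 * (k1^-1 * k2^-1)) * T - T0 =
  (v1 * v2 - 1 * 1) * (l1 * l2 * (k1^-1 * k2^-1) * T) +
  (k1^-1 * k2^-1) * (l1 * l2 * T - k1 * k2 * T0) by field; rewrite k10 k20.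
apply: rpredD; last exact: pIMl.
apply: pIMr; last by apply: rpredM => //; apply: rpredM.
by apply: eqmM; rewrite ?rpred1.
Qed.

(** Descent along [k = b p + a]: [coeff_block] reduces [coeff (b p)] to [coeff b] with [b < k], and
    [hterm] is integral. *)
Lemma zloc_coeff k : coeff k \in zloc p.
Proof.
elim/ltn_ind: k => k IH; have p0 := prime_gt0 p_pr.
have [->|k0] := posnP k.
  by rewrite /coeff /wpair /poch !big_ord0 fact0 expr1n divr1 !mulr1 rpred1.
rewrite (divn_eq k p) coeff_add; apply: rpredM; last first.
  by apply: zloc_hterm; rewrite ?ltn_pmod // natrM pIMl ?rpred_nat // (pIpX 1).
have [v [vz -> _]] := coeff_block (k %/ p)%N.
by rewrite rpredM // IH // ltn_Pdiv // prime_gt1.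
Qed.

Lemma Ftrunc_blocks s : Ftrunc p s.+1 r1 r2 =
  \sum_(b < p ^ s) coeff (b * p) * \sum_(a < p) hterm r1 r2 a (b * p)%:R.
Proof.
rewrite /Ftrunc expnSr; under eq_bigr do rewrite -coeff_pochE.
rewrite -(big_mkord xpredT coeff) big_nat_mul big_mkord; apply: eq_bigr => b _.
rewrite -{1}[(b * p)%N]add0n big_addn mulSn addnK big_mkord mulr_sumr.
by apply: eq_bigr => a _; rewrite addnC coeff_add.
Qed.

Lemma Ftrunc1 : Ftrunc p 1 r1 r2 = \sum_(a < p) hterm r1 r2 a 0.
Proof.
rewrite Ftrunc_blocks expn0 big_ord1 mul0n /coeff /wpair /poch !big_ord0 fact0.
by rewrite expr1n divr1 !mul1r.
Qed.

(** The congruence holds block by block: the b-th difference is [coeff b], an integral factor, times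
    the difference in [coeff_block]. *)
Lemma Ftrunc_dwork s : Ftrunc p s.+1 r1 r2 - Ftrunc p s r1 r2 * Ftrunc p 1 r1 r2 \in pI 3.
Proof.
rewrite Ftrunc_blocks Ftrunc1 mulr_suml -sumrB rpred_sum // => b _.
have [v [_ -> vT]] := coeff_block b.
by rewrite -coeff_pochE -mulrA -mulrBr pIMl ?zloc_coeff.
Qed.

End DashClosed.

End SuperCongruence.

Theorem theorem3p3 (p : nat) (r1 r2 : rat)
    (p_prime : prime p) (p_gt5 : (5 < p)%N)
    (r1_unit : padic_unit p r1) (r2_unit : padic_unit p r2)
    (alpha_closed : dash_closed p (alpha r1 r2)) :
  forall s : nat, (1 <= s)%N ->
    padic_eqmod p 3 (Ftrunc p s.+1 r1 r2)
                    (Ftrunc p s r1 r2 * Ftrunc p 1 r1 r2)%R.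
Proof.
move=> s _; rewrite eqmodE; apply: Ftrunc_dwork => //; last 2 first.
- exact: zunit_zloc r1_unit.
- exact: zunit_zloc r2_unit.
- by apply: leq_trans p_gt5.
Qed.
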